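(* Let $k\ge 0$ be an integer. If $\pi\in\mathfrak{S}_n$ contains no $k$-zigzag pattern, then $\mathcal{T}^k(\pi)=\mathrm{id}$.
   Context: $\mathfrak{S}_n$ is the set of permutations of $\{1,\ldots,n\}$, written as words $\pi=\pi_1\cdots\pi_n$; $\pi^{-1}(x)$ is the position of the value $x$ in $\pi$; $\mathrm{id}=12\cdots n$. The operator $\mathcal{T}$ (revstack sort) is defined recursively on finite words of distinct positive integers by $\mathcal{T}(\epsilon)=\epsilon$ for the empty word $\epsilon$, $\mathcal{T}(x)=x$ for a word $x$ of length 1, and $\mathcal{T}(LmR)=\mathcal{T}(R)\,\mathcal{T}(L)\,m$, where $m$ is the largest entry of $LmR$; $\mathcal{T}^k$ is its $k$-fold iterate. A $k$-zigzag pattern in $\pi$ is a sequence $z=(z_0,\ldots,z_{k+1})$ of values of $\pi$ such that (a) $z_0>z_1>\cdots>z_{k+1}$, and (b) $\pi^{-1}(z_{2i})<\pi^{-1}(z_0)<\pi^{-1}(z_{2i-1})$ for all $i\ge 1$ (each inequality being required whenever the index involved is at most $k+1$). That is, the entries with positive even index lie to the left of $z_0$ in $\pi$ and the entries with odd index lie to the right of $z_0$. *)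

(* Defs.v *)
From mathcomp Require Import all_boot all_fingroup.
Set Implicit Arguments.
Unset Strict Implicit.
Unset Printing Implicit Defensive.

(* The first argument bounds the recursion depth; [size w] is always enough,
   see [revstack_rec_fuel] and [revstack_cat]. *)
Fixpoint revstack_rec (fuel : nat) (w : seq nat) : seq nat :=
  match fuel, w with
  | f.+1, _ :: _ =>
      let m := \max_(x <- w) x in
      let i := index m w in
      rcons (revstack_rec f (drop i.+1 w) ++ revstack_rec f (take i w)) m
  | _, _ => [::]
  end.

Definition revstack (w : seq nat) : seq nat := revstack_rec (size w) w.

Lemma revstack_nil : revstack [::] = [::].
Proof. by []. Qed.

Lemma max_cat (L R : seq nat) (m : nat) :
  all (ltn^~ m) L -> all (ltn^~ m) R -> \max_(x <- L ++ m :: R) x = m.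
Proof.
move=> /allP ltL /allP ltR; apply/eqP; rewrite eqn_leq; apply/andP; split.
  apply/bigmax_leqP_seq => x + _; rewrite mem_cat inE.
  by case/or3P=> [/ltL/ltnW|/eqP->|/ltR/ltnW].
by rewrite big_cat big_cons /= leq_max leq_maxl orbT.
Qed.

Lemma revstack_rec_cat f (L R : seq nat) (m : nat) :
  all (ltn^~ m) L -> all (ltn^~ m) R ->
  revstack_rec f.+1 (L ++ m :: R) =
  rcons (revstack_rec f R ++ revstack_rec f L) m.
Proof.
move=> ltL ltR; set w := L ++ _.
have mL : m \notin L by apply/negP => /(allP ltL) /=; rewrite ltnn.
have iw : index m w = size L.
  by rewrite /w index_cat (negPf mL) /= eqxx addn0.
have -> : revstack_rec f.+1 w =
  let i := index (\max_(x <- w) x) w in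
  rcons (revstack_rec f (drop i.+1 w) ++ revstack_rec f (take i w))
        (\max_(x <- w) x) by rewrite /w; case: (L).
rewrite /= max_cat // iw /w take_size_cat // -cat_rcons drop_size_cat //.
by rewrite size_rcons.
Qed.

Lemma revstack_rec_fuel f (w : seq nat) :
  size w <= f -> revstack_rec f w = revstack w.
Proof.
have main : forall n f g (v : seq nat), size v <= n -> size v <= f ->
    size v <= g -> revstack_rec f v = revstack_rec g v.
  elim=> [|n IH] {}f g [|x s] //=; [by case: f g => [|f] [|g] .. |].
  case: f g => [|f] [|g] //; rewrite !ltnS => sn sf sg.
  set v := x :: s; set m := \max_(y <- v) y; set i := index m v.
  have Di : size (drop i.+1 v) <= size s by rewrite size_drop subSS leq_subr.
  have mv : m \in v.
    rewrite /m /v; elim: (s) (x) => [|y t IHt] z.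
      by rewrite big_seq1 mem_head.
    by rewrite big_cons inE; case: leqP; rewrite ?eqxx // IHt orbT.
  have Ti : size (take i v) <= size s.
    by rewrite size_take index_mem mv -ltnS -[(size s).+1]/(size v) index_mem.
  rewrite /= -/v -/m -/i; congr rcons; congr cat; apply: IH;
    by apply: leq_trans sn || apply: leq_trans sf || apply: leq_trans sg.
by move=> le; apply: (main (size w)).
Qed.

Lemma revstack_cat (L R : seq nat) (m : nat) :
  all (ltn^~ m) L -> all (ltn^~ m) R ->
  revstack (L ++ m :: R) = rcons (revstack R ++ revstack L) m.
Proof.
move=> ltL ltR; rewrite /revstack size_cat /= addnS revstack_rec_cat //.
by rewrite !revstack_rec_fuel ?leq_addr ?leq_addl.
Qed.

(* Ordinals start at 0, so the values are shifted to get a word on 1, ..., n. *)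
Definition word (n : nat) (pi : 'S_n) : seq nat :=
  [seq (nat_of_ord (pi i)).+1 | i <- enum 'I_n].

(* The values z_i are unshifted; only their order matters. *)
Definition zigzag (n k : nat) (pi : 'S_n) (z : 'I_k.+2 -> 'I_n) : Prop :=
  let pos x : 'I_n := (pi^-1)%g x in
  (forall i j : 'I_k.+2, i < j -> z j < z i) /\
  (forall j : 'I_k.+2, 0 < j ->
     if odd j then pos (z ord0) < pos (z j) else pos (z j) < pos (z ord0)).

(* Main.v *)
Require Import Defs.
From mathcomp Require Import all_boot all_fingroup.
Set Implicit Arguments.
Unset Strict Implicit.
Unset Printing Implicit Defensive.

(** A zigzag of length [k.+2] in [revstack w] can be lengthened to one of
    length [k.+3] in [w].  Hence a word without [k]-zigzag has, after [k]
    passes, no 0-zigzag; a 0-zigzag is an inversion, so the result is sorted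
    ([iter_revstack_sorted]).

    To lengthen a zigzag, let [a] be its top entry and let [c] be the nearest
    entry larger than [a] on the left of [a] in [w].  An entry [b < a] follows
    [a] in [revstack w] exactly when it precedes [a] in [w] with some entry
    larger than [a] in between, that is, when [b] precedes [c] in [w]
    ([revstack_after]).  If [a] has no such [c], nothing smaller follows it in
    [revstack w], and it tops no zigzag.  Otherwise the entries of odd index
    lie in [w] to the left of [c], those of positive even index to its right,
    and so does [a]; putting [c] in front of the zigzag shifts all indices by
    one and turns these sides into the required ones ([has_zigzag_revstack]). *)

(** The recursion scheme of [revstack] itself, which its fuel-based definition
    hides; distinctness of the entries makes the inequalities strict. *)
Lemma max_split_ind (P : seq nat -> Prop) :
  P [::] ->
  (forall L m R, all (ltn^~ m) L -> all (ltn^~ m) R -> uniq (L ++ m :: R) ->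
     P L -> P R -> P (L ++ m :: R)) ->
  forall w, uniq w -> P w.
Proof.
move=> P0 PS w; have [n] := ubnP (size w).
elim: n w => // n IH [//|x s]; set w := x :: s => szw Uw.
have [m mw mmax] : exists2 m, m \in w & forall y, y \in w -> y <= m.
  have [i _ imax] := @arg_maxnP _ (ord0 : 'I_(size w)) predT (nth 0 w) isT.
  exists (nth 0 w i) => [|y yw]; first exact: mem_nth.
  have iy : index y w < size w by rewrite index_mem.
  by have := imax (Ordinal iy) isT; rewrite /= nth_index.
move: szw Uw mmax; case/splitPr: mw => L R szw Uw mmax.
have lt_m y : y \in L ++ R -> y < m.
  move=> yLR; rewrite ltn_neqAle mmax ?andbT.
    apply/eqP => ym; move: Uw; rewrite -cat_rcons -(perm_uniq (s1 := m :: (L ++ R))).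
      by rewrite /= -ym yLR.
    by rewrite cat_rcons perm_sym -cat1s perm_catCA.
  by move: yLR; rewrite !mem_cat inE => /orP[->|->]; rewrite ?orbT.
have /and3P[UL _ /andP[_ UR]] : [&& uniq L, ~~ has (mem L) (m :: R) & uniq (m :: R)].
  by rewrite -cat_uniq.
move: szw; rewrite size_cat /= addnS !ltnS => szw.
apply: PS => //.
- by apply/allP => y yL; apply: lt_m; rewrite mem_cat yL.
- by apply/allP => y yR; apply: lt_m; rewrite mem_cat yR orbT.
- by apply: IH => //; apply: leq_trans szw; rewrite ltnS leq_addr.
- by apply: IH => //; apply: leq_trans szw; rewrite ltnS leq_addl.
Qed.

Lemma perm_revstack w : uniq w -> perm_eq (revstack w) w.
Proof.
move: w; apply: max_split_ind => // L m R ltL ltR _ IHL IHR.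
move/seq.permP: IHL => IHL; move/seq.permP: IHR => IHR; apply/seq.permP => p.
rewrite revstack_cat // -cats1 !count_cat /= addn0 IHL IHR.
by rewrite [count p R + _]addnC -addnA [count p R + _]addnC.
Qed.

(** Locates the entries that follow a given [a] after a pass.  One [c] serves
    all [b] at once: it is the nearest larger entry on the left of [a]. *)
Lemma revstack_after w : uniq w -> forall a, a \in w ->
  (forall b, b \in w -> b < a -> index b (revstack w) < index a (revstack w))
  \/ exists c, [/\ c \in w, a < c, index c w < index a w &
       forall b, b \in w -> b < a ->
         (index a (revstack w) < index b (revstack w))
         = (index b w < index c w)].
Proof.
move: w; apply: max_split_ind => // L m R ltL ltR Uw IHL IHR a.
have ltLm x : x \in L -> x < m by move/(allP ltL).
have ltRm x : x \in R -> x < m by move/(allP ltR).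
move: (Uw); rewrite cat_uniq => /and3P[UL]; rewrite /= negb_or.
case/andP=> _ /hasPn disj /andP[mR UR].
have memL := perm_mem (perm_revstack UL).
have memR := perm_mem (perm_revstack UR).
have RL x : x \in R -> (x \in L) = false by move/disj/negbTE.
have LR x : x \in L -> (x \in R) = false by move=> xL; apply/negP => /RL; rewrite xL.
have LnR x : x \in L -> (m == x) = false by move=> xL; rewrite gtn_eqF ?ltLm.
have RnR x : x \in R -> (m == x) = false by move=> xR; rewrite gtn_eqF ?ltRm.
have mL : (m \in L) = false by apply/negP => /ltLm; rewrite ltnn.
(* Positions before and after the pass, for entries of L, of R, and for m. *)
have wL x : x \in L -> index x (L ++ m :: R) = index x L.
  by move=> xL; rewrite index_cat xL.
have wR x : x \in R -> index x (L ++ m :: R) = size L + (index x R).+1.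
  by move=> xR; rewrite index_cat RL //= RnR.
have wm : index m (L ++ m :: R) = size L by rewrite index_cat mL /= eqxx addn0.
have iL x : x \in L -> index x L < size L by rewrite index_mem.
rewrite revstack_cat // -cats1.
set T := (_ ++ _) ++ _.
have TR x : x \in R -> index x T = index x (revstack R).
  by move=> xR; rewrite /T -catA index_cat memR xR.
have TL x : x \in L -> index x T = size (revstack R) + index x (revstack L).
  by move=> xL; rewrite /T -catA !index_cat memR LR // memL xL.
have Tm : index m T = size (revstack R) + size (revstack L).
  by rewrite /T -catA !index_cat memR (negPf mR) memL mL /= eqxx addn0.
have sL x : x \in L -> index x (revstack L) < size (revstack L).
  by rewrite index_mem memL.
have sR x : x \in R -> index x (revstack R) < size (revstack R).
  by rewrite index_mem memR.
have inE' x : x \in L ++ m :: R -> [\/ x \in L, x = m | x \in R].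
  by rewrite mem_cat inE => /or3P[|/eqP|]; [constructor 1|constructor 2|constructor 3].
case/inE'=> [aL|->|aR].
- (* All of R moves in front of L, so only L matters. *)
  have [none|[c [cL ac ca cP]]] := IHL a aL; [left|right; exists c; split].
  + move=> b /inE'[bL|->|bR] ba; rewrite (TL a) //.
    * by rewrite TL // ltn_add2l none.
    * by rewrite ltnNge ltnW ?ltLm in ba.
    * by rewrite TR // ltn_addr ?sR.
  + by rewrite mem_cat cL.
  + by [].
  + by rewrite !wL.
  + move=> b /inE'[bL|->|bR] ba; rewrite (TL a) // (wL c) //.
    * by rewrite TL // wL // ltn_add2l cP.
    * by rewrite ltnNge ltnW ?ltLm in ba.
    * rewrite TR // wR // ltnNge ltnW ?ltn_addr ?sR //=.
      by apply/esym/negbTE; rewrite -leqNgt ltnW // ltn_addr // iL.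
- left=> b /inE'[bL|->|bR] bm; rewrite Tm.
  + by rewrite TL // ltn_add2l sL.
  + by rewrite ltnn in bm.
  + by rewrite TR // ltn_addr // sR.
- (* All of L ends up after a; the nearest larger entry is m unless R has one. *)
  right; have [none|[c [cR ac ca cP]]] := IHR a aR; [exists m|exists c]; split.
  + by rewrite mem_cat inE eqxx orbT.
  + exact: ltRm.
  + by rewrite wm wR // addnS ltnS leq_addr.
  + move=> b /inE'[bL|->|bR] ba; rewrite (TR a) // wm.
    * by rewrite TL // wL // ltn_addr ?sR // iL.
    * by rewrite ltnNge ltnW ?ltRm in ba.
    * rewrite TR // wR // ltnNge ltnW ?none //=.
      by apply/esym/negbTE; rewrite -leqNgt leq_addr.
  + by rewrite mem_cat inE cR !orbT.
  + by [].
  + by rewrite !wR // ltn_add2l ltnS.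
  + move=> b /inE'[bL|->|bR] ba; rewrite (TR a) // (wR c) //.
    * by rewrite TL // wL // !ltn_addr ?sR // iL.
    * by rewrite ltnNge ltnW ?ltRm in ba.
    * by rewrite TR // wR // ltn_add2l ltnS cP.
Qed.

(** The entries are given by a function on all of [nat], so that putting an
    entry in front is a plain shift of indices. *)
Definition has_zigzag (k : nat) (w : seq nat) : Prop :=
  exists z : nat -> nat,
  [/\ forall i, i <= k.+1 -> z i \in w,
      forall i j, i < j -> j <= k.+1 -> z j < z i &
      forall j, 0 < j -> j <= k.+1 ->
        if odd j then index (z 0) w < index (z j) w
        else index (z j) w < index (z 0) w].

(** The new top entry [c] separates the odd-indexed entries from the others,
    so it can be put in front. *)
Lemma has_zigzag_revstack k w :
  uniq w -> has_zigzag k (revstack w) -> has_zigzag k.+1 w.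
Proof.
move=> Uw [z [zw zlt zpos]].
have memT := perm_mem (perm_revstack Uw).
have zin i : i <= k.+1 -> z i \in w by move/zw; rewrite memT.
have [none|[c [cw ac ca cP]]] := revstack_after Uw (zin 0 isT).
  have := zpos 1 isT isT; rewrite /= ltnNge ltnW //.
  by apply: none; [apply: zin | apply: zlt].
exists (fun i => if i is i'.+1 then z i' else c); split.
- by case=> [//|i]; rewrite ltnS => /zin.
- case=> [|i] [|j] //; rewrite !ltnS; last by apply: zlt.
  by case: j => [//|j] _ jk; apply: ltn_trans ac; apply: zlt.
- case=> [//|[_ _ //|j]] _; rewrite ltnS => jk /=.
  have := zpos j.+1 isT jk; rewrite /= negbK.
  have zj0 : z j.+1 < z 0 by apply: zlt.
  have zjw := zin _ jk.
  case: (odd j) => /= lt_j; last by rewrite -cP.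
  rewrite ltn_neqAle leqNgt -cP // -leqNgt (ltnW lt_j) andbT.
  apply/eqP => /(congr1 (nth 0 w)); rewrite !nth_index // => cz.
  by move: ac; rewrite cz ltnNge ltnW.
Qed.

(** An adjacent descent is already a 0-zigzag. *)
Lemma no_inversion_sorted w : uniq w -> ~ has_zigzag 0 w -> sorted ltn w.
Proof.
move=> Uw noz; apply/(sortedP 0) => i iw; rewrite /= ltnNge leq_eqVlt.
apply/negP => /orP[|lt_i].
  by rewrite nth_uniq ?(ltnW iw) // (gtn_eqF (ltnSn i)).
apply: noz; exists (fun j => nth 0 w (i + j)); split.
- by case=> [|[|//]] _; rewrite ?addn0 ?addn1 mem_nth // ltnW.
- by case=> [|i'] [|[|//]] //; rewrite ?addn0 ?addn1.
- by case=> [|[|//]] //; rewrite ?addn0 ?addn1 !index_uniq ?(ltnW iw) /=.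
Qed.

Lemma perm_iter_revstack k w : uniq w -> perm_eq (iter k revstack w) w.
Proof.
elim: k w => //= k IH w Uw; apply: perm_trans (IH w Uw).
by apply: perm_revstack; rewrite (perm_uniq (IH w Uw)).
Qed.

Lemma iter_revstack_sorted k w :
  uniq w -> ~ has_zigzag k w -> sorted ltn (iter k revstack w).
Proof.
elim: k w => [|k IH] w Uw noz; first exact: no_inversion_sorted.
rewrite iterSr; apply: IH => [|hz]; first by rewrite (perm_uniq (perm_revstack Uw)).
by apply: noz; apply: has_zigzag_revstack.
Qed.

Lemma word_letter_inj n (pi : 'S_n) : injective (fun i => (nat_of_ord (pi i)).+1).
Proof. by move=> i j [] /ord_inj/perm_inj. Qed.

Lemma uniq_word n (pi : 'S_n) : uniq (word pi).
Proof. by rewrite (map_inj_uniq (@word_letter_inj _ pi)) enum_uniq. Qed.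

Lemma perm_word n (pi : 'S_n) : perm_eq (word pi) (iota 1 n).
Proof.
apply: uniq_perm; rewrite ?uniq_word ?iota_uniq // => x.
rewrite mem_iota add1n ltnS; apply/mapP/idP => [[i _ ->]|]; first exact: ltn_ord.
case: x => //= x xn.
by exists ((pi^-1)%g (Ordinal xn)); rewrite ?mem_enum ?permKV.
Qed.

Lemma index_word n (pi : 'S_n) (x : 'I_n) :
  index x.+1 (word pi) = (pi^-1)%g x.
Proof.
rewrite -{1}(permKV pi x).
by rewrite (index_map (@word_letter_inj _ pi)) index_enum_ord.
Qed.

Lemma has_zigzag_word n k (pi : 'S_n) :
  has_zigzag k (word pi) -> exists z : 'I_k.+2 -> 'I_n, zigzag pi z.
Proof.
case=> z [zw zlt zpos].
have [j|f zf] := @fin_all_exists 'I_k.+2 (fun=> 'I_n) (fun j x => z j = x.+1).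
  have /mapP[i _ zi] := zw j (ltn_ord j); by exists (pi i).
exists f; split=> [i j ij|j j0].
  by have := zlt _ _ ij (ltn_ord j); rewrite !zf.
have := zpos _ j0 (ltn_ord j).
by rewrite (zf ord0 : z 0 = _) zf !index_word.
Qed.

Theorem theorem2p7 (n k : nat) (pi : 'S_n)
  (no_zigzag : ~ exists z : 'I_k.+2 -> 'I_n, zigzag pi z) :
  iter k revstack (word pi) = iota 1 n.
Proof.
have Uw := uniq_word pi.
apply: (irr_sorted_eq ltn_trans ltnn).
- by apply: iter_revstack_sorted => // /has_zigzag_word.
- exact: iota_ltn_sorted.
- by apply: perm_mem; apply: perm_trans (perm_word pi); apply: perm_iter_revstack.
Qed.
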